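(* Assume the abc-conjecture, and fix an integer $\omega_0\ge 2$. Then for all $\varepsilon>0$, $\alpha\ge 0$ and $\beta\ge\omega_0$, over abc-triples with $\omega(abc)=\omega_0$, $$\limsup_{c\to\infty,\ \omega(abc)=\omega_0} q_C(a,b,c;\alpha,\beta)\ \le\ (1+\varepsilon)^{\beta/\omega_0}\,\omega_0^{\beta/\omega_0-\alpha\beta}\,K(\beta,\omega_0),\qquad K(\beta,\omega_0):=(\ln 2)^{-\beta(1-1/\omega_0)} .$$ Thus $\limsup_{c\to\infty,\ \omega(abc)=\omega_0} q_C(a,b,c;\alpha,\beta)<\infty$ for $\beta=\omega_0$, and this limsup vanishes for all $\beta>\omega_0$.
   Context: An abc-triple is a triple $(a,b,c)$ of positive integers with $a+b=c$ and $\gcd(a,b)=\gcd(b,c)=\gcd(a,c)=1$; $\omega=\omega(abc)$ is the number of distinct primes $p_1,\dots,p_{\omega}$ dividing $abc$. The radical $\mathrm{rad}(n)$ is the product of the distinct primes dividing $n$, and the standard quality is $q_s(a,b,c)=\ln c/\ln(\mathrm{rad}(abc))$. The abc-conjecture: for every real $\varepsilon>0$ there are only finitely many abc-triples with $q_s(a,b,c)>1+\varepsilon$. For $\alpha\ge0$, $\beta>0$, the DGM quality class is $$q_C(a,b,c;\alpha,\beta)=\frac{\ln c}{(\ln \mathrm{DGM}(U))^\beta},\qquad U=\{p_i^{\omega^\alpha}: p_i\mid abc,\ p_i\text{ prime}\},$$ where $\mathrm{DGM}(\{x_1,\dots,x_m\})=\exp(\exp(\tfrac1m\sum_{i}\ln\ln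 x_i))$; equivalently $q_C(a,b,c;\alpha,\beta)=\ln c\,\big/\,\big(\omega^\alpha(\prod_{i=1}^{\omega}\ln p_i)^{1/\omega}\big)^\beta$. *)

(* Defs.v *)
From HB Require Import structures.
From mathcomp Require Export all_boot all_order all_algebra finmap.
From mathcomp Require Export all_classical all_reals all_analysis.

Set Implicit Arguments.
Unset Strict Implicit.
Unset Printing Implicit Defensive.

Import Order.TTheory GRing.Theory Num.Theory.

Local Open Scope classical_set_scope.
Local Open Scope ring_scope.

Definition abc_triple (a b c : nat) : Prop :=
  [/\ [/\ (0 < a)%N, (0 < b)%N & (0 < c)%N],
      (a + b)%N = c,
      gcdn a b = 1%N,
      gcdn b c = 1%N &
      gcdn a c = 1%N].

Definition omega (n : nat) : nat := size (primes n).

Definition rad (n : nat) : nat := (\prod_(p <- primes n) p)%N.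

(* Families indexed by triples are functions on [nat * nat * nat]; the triple
   [t] stands for (a, b, c) = (t.1.1, t.1.2, t.2). *)
Definition abc_prod (t : nat * nat * nat) : nat := (t.1.1 * t.1.2 * t.2)%N.

Definition abc_triples : set (nat * nat * nat) :=
  [set t | abc_triple t.1.1 t.1.2 t.2].

Definition abc_triples_omega (w : nat) : set (nat * nat * nat) :=
  [set t | abc_triples t /\ omega (abc_prod t) = w].

Definition quality_std (R : realType) (t : nat * nat * nat) : R :=
  ln (t.2)%:R / ln (rad (abc_prod t))%:R.

Definition abc_conjecture (R : realType) : Prop :=
  forall eps : R, 0 < eps ->
    finite_set [set t | abc_triples t /\ 1 + eps < quality_std R t].

Definition DGM (R : realType) (U : {fset R}) : R :=
  expR (expR ((#|` U|)%:R^-1 * \sum_(x <- U) ln (ln x))).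

Definition prime_powers (R : realType) (alpha : R) (n : nat) : {fset R} :=
  [fset p%:R `^ ((omega n)%:R `^ alpha) | p in primes n]%fset.

Definition quality_DGM (R : realType) (alpha beta : R)
    (t : nat * nat * nat) : R :=
  ln (t.2)%:R / ln (DGM (prime_powers alpha (abc_prod t))) `^ beta.

(* The filter "c -> oo along the abc-triples with omega(abc) = w".  It is
   proper if and only if there are infinitely many such triples. *)
Definition abc_infty (w : nat) : set_system (nat * nat * nat) :=
  filter_from [set: nat]
    (fun N => [set t | abc_triples_omega w t /\ (N <= t.2)%N]).

(* As [ereal_sup set0 = -oo], this equals [-oo] when only finitely many
   abc-triples satisfy omega(abc) = w. *)
Definition limsup_quality_DGM (R : realType) (w : nat) (alpha beta : R) :
    \bar R :=
  limf_esup (fun t => (quality_DGM alpha beta t)%:E) (abc_infty w).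

Definition K_const (R : realType) (beta : R) (w : nat) : R :=
  ln 2 `^ (- (beta * (1 - w%:R^-1))).

(* Main.v *)
(* Write P for the product of the [ln p] over the [w] primes [p] dividing abc,
   so that [ln (DGM U) = w^alpha * P^(1/w)].  For all but finitely many triples
   the abc-conjecture gives [ln c <= (1 + eps) ln (rad (abc))], and
   [ln (rad (abc))], the sum of the [ln p], is at most [w] times the largest of
   them, hence at most [w * P / (ln 2)^(w-1)].  Raising to the power
   [beta / w >= 1] bounds [(ln c)^(beta/w)] by a constant multiple of
   [(ln (DGM U))^beta], that is, q_C by a constant over [(ln c)^(beta/w - 1)]. *)
Require Import Defs.
From mathcomp Require Import all_boot all_order all_algebra finmap.
From mathcomp Require Import ring.
From mathcomp Require Import all_classical all_reals all_analysis.

Import Order.TTheory GRing.Theory Num.Theory.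

Local Open Scope classical_set_scope.
Local Open Scope ring_scope.

(** Each single [f i] is at most the product divided by [m ^ (size s).-1], since the [(size s).-1]
    other factors are all at least [m]; adding up these [size s] equal bounds gives the claim. *)
Lemma sum_le_prod_ge {R : realFieldType} {I : eqType} (m : R) (f : I -> R)
    (s : seq I) : 0 < m -> {in s, forall i, m <= f i} ->
  \sum_(i <- s) f i <= (size s)%:R * (m ^- (size s).-1 * \prod_(i <- s) f i).
Proof.
move=> m0 mf.
have bnd i : i \in s -> f i <= m ^- (size s).-1 * \prod_(j <- s) f j.
  move=> si; rewrite (big_rem i si) /= mulrCA -[leLHS]mulr1.
  rewrite ler_pM2l ?(lt_le_trans m0 (mf i si))//.
  rewrite ler_pdivlMl ?exprn_gt0// mulr1 -(size_rem si).
  have: {in rem i s, forall j, m <= f j} by move=> j /mem_rem/mf.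
  elim: (rem i s) => [|j r IH] mr; first by rewrite big_nil expr0.
  rewrite big_cons exprS ler_pM ?exprn_ge0 ?(ltW m0)// ?mr ?mem_head//.
  by apply: IH => k kr; apply: mr; rewrite inE kr orbT.
set B := _ * _ in bnd *.
have -> : (size s)%:R * B = \sum_(i <- s) B.
  by rewrite big_const_seq count_predT iter_addr_0 mulr_natl.
by rewrite big_seq [leRHS]big_seq; apply: ler_sum.
Qed.

Lemma ln_prod {R : realType} {I : eqType} (f : I -> R) (s : seq I) :
  {in s, forall i, 0 < f i} ->
  ln (\prod_(i <- s) f i) = \sum_(i <- s) ln (f i).
Proof.
elim: s => [|i s IH] f0; first by rewrite !big_nil ln1.
have {}IH : ln (\prod_(j <- s) f j) = \sum_(j <- s) ln (f j).
  by apply: IH => j js; rewrite f0// inE js orbT.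
rewrite !big_cons lnM ?IH// posrE ?f0 ?mem_head// big_seq prodr_gt0// => j js.
by rewrite f0// inE js orbT.
Qed.

Section primes.
Context {R : realType}.
Implicit Types (n p : nat).

Lemma ln2_gt0 : 0 < ln 2 :> R.
Proof. by rewrite ln_gt0// ltr1n. Qed.

Lemma ln2_le_ln_prime n : {in primes n, forall p, ln 2 <= ln p%:R :> R}.
Proof.
move=> p; rewrite mem_primes => /andP[pp _].
by rewrite ler_ln ?ler_nat ?posrE ?ltr0n ?prime_gt1 ?prime_gt0.
Qed.

Lemma ln_prime_gt0 n : {in primes n, forall p, 0 < ln p%:R :> R}.
Proof. by move=> p /ln2_le_ln_prime; apply: lt_le_trans ln2_gt0. Qed.

Lemma prod_ln_prime_gt0 n : 0 < \prod_(p <- primes n) ln p%:R :> R.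
Proof. by rewrite big_seq prodr_gt0//; apply: ln_prime_gt0. Qed.

Lemma ln_rad n : ln (Defs.rad n)%:R = \sum_(p <- primes n) ln p%:R :> R.
Proof.
rewrite /Defs.rad natr_prod ln_prod// => p.
by rewrite mem_primes ltr0n => /andP[/prime_gt0].
Qed.

(** Since [ln (ln (p^(w^alpha))) = ln (w^alpha) + ln (ln p)], the mean over the primes is
    [ln (w^alpha) + (ln P) / w], and exponentiating turns it into a product. *)
Lemma ln_DGM_prime_powers (alpha : R) n : (0 < omega n)%N ->
  ln (DGM (prime_powers alpha n)) =
  (omega n)%:R `^ alpha *
  (\prod_(p <- primes n) ln p%:R) `^ (omega n)%:R^-1.
Proof.
move=> n0; set w : R := _%:R; set P := \prod_(p <- _) _.
have w0 : 0 < w by rewrite ltr0n.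
have wa0 : 0 < w `^ alpha by rewrite powR_gt0.
(* Distinct primes have distinct powers, so the finite set [U] has exactly [omega n] elements and
   its sum can be reindexed by [primes n]. *)
have inj : injective (fun p : nat => p%:R `^ (w `^ alpha)).
  move=> p q /(powR_injective wa0).
  by rewrite !nnegrE !ler0n => /(_ isT isT)/eqP; rewrite eqr_nat => /eqP.
rewrite /DGM expRK /prime_powers card_imfset// big_imfset//=; last first.
  by move=> p q _ _; apply: inj.
rewrite !undup_id ?primes_uniq// -/(omega n) -/w.
transitivity (expR (w^-1 * (w * ln (w `^ alpha) + ln P))).
  congr (expR (_ * _)); rewrite /P ln_prod; last exact: ln_prime_gt0.
  have -> : w * ln (w `^ alpha) = \sum_(p <- primes n) ln (w `^ alpha).
    by rewrite big_const_seq count_predT iter_addr_0 mulr_natl.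
  rewrite -big_split/= big_seq [RHS]big_seq; apply: eq_bigr => p pn.
  by rewrite ln_powR lnM// posrE// (@ln_prime_gt0 n).
rewrite mulrDr mulKf ?gt_eqF// expRD lnK ?posrE//; congr (_ * _).
by rewrite /powR gt_eqF ?prod_ln_prime_gt0.
Qed.

Lemma ln_powR_le_ln_DGM (eps alpha beta : R) (w : nat) t :
  (0 < w)%N -> abc_triples_omega w t ->
  0 <= eps -> 0 <= beta ->
  0 <= ln (t.2)%:R :> R -> quality_std R t <= 1 + eps ->
  ln (t.2)%:R `^ (beta / w%:R) <=
  (1 + eps) `^ (beta / w%:R) * w%:R `^ (beta / w%:R - alpha * beta)
    * K_const beta w * ln (DGM (prime_powers alpha (abc_prod t))) `^ beta.
Proof.
move=> w0 [_ tw] eps0 beta0 lnc0 qt; set n := abc_prod t in tw *.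
have wR0 : 0 < w%:R :> R by rewrite ltr0n.
have wR_neq0 : w%:R != 0 :> R by rewrite gt_eqF.
rewrite ln_DGM_prime_powers tw//.
set P := \prod_(p <- _) _; have P0 : 0 < P by exact: prod_ln_prime_gt0.
(* As [w > 0], some prime divides [n]; positivity of the logarithm of the radical allows the
   denominator of [quality_std] to be cleared. *)
have rad0 : 0 < ln (Defs.rad n)%:R :> R.
  rewrite ln_rad; move: w0; rewrite -tw /omega.
  have := @ln_prime_gt0 n; case: (primes n) => // p s s0 _.
  rewrite big_cons ltr_pwDl ?s0 ?mem_head// big_seq sumr_ge0// => q qs.
  by rewrite ltW// s0// inE qs orbT.
have lnc : ln (t.2)%:R <= (1 + eps) * (w%:R * (ln 2 ^- w.-1 * P)).
  move: qt; rewrite /quality_std ler_pdivrMr// => /le_trans; apply.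
  rewrite ler_pM2l ?ltr_pwDl// ln_rad -tw.
  by apply: sum_le_prod_ge ln2_gt0 (@ln2_le_ln_prime n).
have e0 : 0 <= 1 + eps by rewrite addr_ge0.
have l0 : 0 <= (ln 2 : R) ^- w.-1 by rewrite invr_ge0 exprn_ge0 ?ltW ?ln2_gt0.
have bw0 : 0 <= beta / w%:R by rewrite divr_ge0// ltW.
apply: (le_trans (ge0_ler_powR bw0 _ _ lnc)) => //.
  by rewrite nnegrE !mulr_ge0// ltW.
rewrite !powRM ?mulr_ge0 ?powR_ge0 ?(ltW P0)// -2!powRrM.
have -> : w%:R^-1 * beta = beta / w%:R by rewrite mulrC.
(* The exponents agree because [(w - 1) / w = 1 - 1 / w]. *)
have -> : (ln 2 ^- w.-1) `^ (beta / w%:R) = K_const beta w.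
  rewrite /K_const -powR_mulrn ?ltW ?ln2_gt0// -powRN -powRrM; congr (_ `^ _).
  rewrite -subn1 natrB//; by field.
(* Of the two powers of [w], [w^(beta / w)] comes from the number of primes in the sum, while
   [w^(- alpha beta)] cancels the factor [w^(alpha beta)] of [(ln DGM)^beta]. *)
rewrite powRD ?powRN; last by rewrite wR_neq0 implybT.
rewrite [leRHS](_ : _ = (1 + eps) `^ (beta / w%:R) * (w%:R `^ (beta / w%:R) *
  (K_const beta w * P `^ (beta / w%:R)))); first by [].
by field; rewrite gt_eqF ?powR_gt0.
Qed.

(** Writing [ln c] as [(ln c)^(beta / w)] over [(ln c)^(beta / w - 1)] isolates the decay in [c]
    that decides between a finite and a zero limsup. *)
Lemma quality_DGM_le (eps alpha beta : R) (w : nat) t :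
  (0 < w)%N -> abc_triples_omega w t ->
  0 <= eps -> 0 <= beta ->
  0 < ln (t.2)%:R :> R -> quality_std R t <= 1 + eps ->
  quality_DGM alpha beta t <=
  (1 + eps) `^ (beta / w%:R) * w%:R `^ (beta / w%:R - alpha * beta)
    * K_const beta w / ln (t.2)%:R `^ (beta / w%:R - 1).
Proof.
move=> w0 tw eps0 beta0 lnc0 qt.
have := ln_powR_le_ln_DGM eps alpha beta w t w0 tw eps0 beta0 (ltW lnc0) qt.
set B := (_ * K_const _ _); set L := ln _ in lnc0 *.
rewrite /quality_DGM -/L; set g := ln (DGM _).
have g0 : 0 < g `^ beta.
  rewrite powR_gt0// /g /DGM expRK expR_gt0//.
move=> LB; rewrite ler_pdivlMr ?powR_gt0// mulrAC ler_pdivrMr//.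
apply: le_trans LB.
by rewrite -{1}(powRr1 (ltW lnc0)) -powRD ?(gt_eqF lnc0) ?implybT// addrC subrK.
Qed.

Lemma abc_bound (eps M : R) : abc_conjecture R -> 0 < eps ->
  exists N : nat, forall t, abc_triples t -> (N <= t.2)%N ->
    M <= ln (t.2)%:R /\ quality_std R t <= 1 + eps.
Proof.
move=> abc /abc /finite_fsetP[X XE].
(* [N1] lies beyond every exceptional triple of the abc-conjecture, and [N2] beyond [expR M]. *)
pose N1 := (\max_(t <- X) t.2).+1; pose N2 := (Num.trunc (expR M)).+1.
exists (maxn N1 N2) => t abct; rewrite geq_max => /andP[N1c N2c]; split.
  have Mc : expR M <= t.2%:R.
    by rewrite (le_trans (ltW (truncnS_gt _)))// ler_nat.
  rewrite -[leLHS]expRK ler_ln// ?posrE ?expR_gt0//.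
  exact: lt_le_trans (expR_gt0 _) Mc.
rewrite leNgt; apply/negP => qt.
have tX : t \in X by have : [set` X] t by rewrite -XE.
by move: N1c; rewrite ltnNge (leq_bigmax_seq t).
Qed.

(** The limsup is an infimum of suprema over the sets of the filter, so one tail suffices. An empty
    tail is harmless: its supremum is [-oo]. *)
Lemma limsup_quality_DGM_le w (alpha beta B : R) :
  (exists N : nat, forall t, abc_triples_omega w t -> (N <= t.2)%N ->
    quality_DGM alpha beta t <= B) ->
  (limsup_quality_DGM w alpha beta <= B%:E)%E.
Proof.
move=> [N qB]; set V := [set t | abc_triples_omega w t /\ (N <= t.2)%N].
apply: (@le_trans _ _
    (ereal_sup [set (quality_DGM alpha beta t)%:E | t in V])).
  by apply: ereal_inf_lbound; exists V => //; exists N.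
by apply: ge_ereal_sup => _ [t [tw Nt] <-]; rewrite lee_fin qB.
Qed.

(** Infinitude makes every tail nonempty: since [a] and [b] are at most [c], only finitely many
    triples have [c < N]. Each tail thus contains a nonnegative quality. *)
Lemma limsup_quality_DGM_ge0 w (alpha beta : R) :
  infinite_set (abc_triples_omega w) ->
  (0 <= limsup_quality_DGM w alpha beta)%E.
Proof.
move=> winf; apply: le_ereal_inf_tmp => _ [V [N _ NV] <-].
have [t tw Nt] : exists2 t, abc_triples_omega w t & (N <= t.2)%N.
  apply: contra_notP winf => noN.
  apply: (@sub_finite_set _ _ ((`I_N `*` `I_N) `*` `I_N)); last first.
    by do 2?[apply: finite_setX]; exact: finite_II.
  move=> [[a b] c] tw; have cN : (c < N)%N.
    by rewrite ltnNge; apply/negP => Nc; apply: noN; exists (a, b, c).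
  case: tw => -[_ /= abc _ _ _] _; split=> //=; split=> /=.
    by rewrite (leq_ltn_trans _ cN)// -abc leq_addr.
  by rewrite (leq_ltn_trans _ cN)// -abc leq_addl.
apply: (@le_trans _ _ (quality_DGM alpha beta t)%:E).
  rewrite lee_fin /quality_DGM divr_ge0 ?powR_ge0// ln_ge0// ler1n.
  by case: tw => -[[_ _ c0] _ _ _ _] _.
by apply: ereal_sup_ubound; exists t => //; apply: NV.
Qed.

End primes.

Theorem theorem4p8 (R : realType) (habc : abc_conjecture R)
    (w0 : nat) (hw0 : (2 <= w0)%N) :
  [/\ (forall eps alpha beta : R, 0 < eps -> 0 <= alpha -> w0%:R <= beta ->
        (limsup_quality_DGM w0 alpha beta <=
          ((1 + eps) `^ (beta / w0%:R)
            * w0%:R `^ (beta / w0%:R - alpha * beta)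
            * K_const beta w0)%:E)%E),
      (forall alpha : R, 0 <= alpha ->
        (limsup_quality_DGM w0 alpha w0%:R < +oo)%E) &
      (forall alpha beta : R, 0 <= alpha -> w0%:R < beta ->
        (limsup_quality_DGM w0 alpha beta <= 0)%E /\
        (infinite_set (abc_triples_omega w0) ->
          limsup_quality_DGM w0 alpha beta = 0%E))].
Proof.
have w_gt0 : (0 < w0)%N by exact: leq_trans hw0.
have wR_gt0 : 0 < w0%:R :> R by rewrite ltr0n.
have bound (eps alpha beta : R) : 0 < eps -> w0%:R <= beta ->
    (limsup_quality_DGM w0 alpha beta <=
      ((1 + eps) `^ (beta / w0%:R) * w0%:R `^ (beta / w0%:R - alpha * beta)
        * K_const beta w0)%:E)%E.
  move=> eps0 wb; apply: limsup_quality_DGM_le.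
  have [N NP] := abc_bound eps 1 habc eps0.
  exists N => t tw Nt; have [lnc qt] := NP t tw.1 Nt.
  apply: le_trans (quality_DGM_le eps alpha beta w0 t w_gt0 tw (ltW eps0)
    (le_trans (ltW wR_gt0) wb) (lt_le_trans ltr01 lnc) qt) _.
  have L1 : 1 <= ln (t.2)%:R `^ (beta / w0%:R - 1) :> R.
    by rewrite -[leLHS](powRr0 (ln t.2%:R)) ler_powR// subr_ge0 ler_pdivlMr ?mul1r.
  rewrite ler_pdivrMr ?(lt_le_trans ltr01)// ler_peMr//.
  by rewrite !mulr_ge0 ?powR_ge0.
split=> [eps alpha beta eps0 _|alpha _|alpha beta _ wb]; first exact: bound.
  (* Any positive [eps] would do; [1] is taken. *)
  exact: le_lt_trans (bound 1 alpha w0%:R ltr01 (lexx _)) (ltry _).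
have lim0 : (limsup_quality_DGM w0 alpha beta <= 0)%E.
  apply/lee_addgt0Pr => d d0; rewrite add0e; apply: limsup_quality_DGM_le.
  set B : R := (1 + 1) `^ (beta / w0%:R)
    * w0%:R `^ (beta / w0%:R - alpha * beta) * K_const beta w0.
  have B0 : 0 <= B by rewrite !mulr_ge0 ?powR_ge0.
  set g := beta / w0%:R - 1.
  have g0 : 0 < g by rewrite subr_gt0 ltr_pdivlMr// mul1r.
  have Bd0 : 0 <= B / d by rewrite divr_ge0// ltW.
  (* The entry [1] of the maximum keeps [ln c] positive; the other gives [(ln c)^g >= B / d], that
     is, [B / (ln c)^g <= d]. *)
  have [N NP] := abc_bound 1 (Num.max 1 ((B / d) `^ g^-1)) habc ltr01.
  exists N => t tw Nt; have [] := NP t tw.1 Nt.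
  rewrite ge_max => /andP[lnc1 lncB] qt.
  have lnc0 : 0 < ln t.2%:R :> R := lt_le_trans ltr01 lnc1.
  apply: le_trans (quality_DGM_le 1 alpha beta w0 t w_gt0 tw ler01
    (ltW (lt_trans wR_gt0 wb)) lnc0 qt) _.
  rewrite -/B -/g ler_pdivrMr ?powR_gt0// mulrC -ler_pdivrMr//.
  have -> : B / d = ((B / d) `^ g^-1) `^ g.
    by rewrite -powRrM mulVf ?gt_eqF// powRr1.
  by rewrite ge0_ler_powR ?nnegrE ?powR_ge0 ?(ltW g0) ?(ltW lnc0).
(* With finitely many triples the limsup would be [-oo], so equality with [0] is derived from
   [winf]. *)
split=> // winf; apply/eqP; rewrite eq_le lim0/=.
exact: limsup_quality_DGM_ge0.
Qed.
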